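(* The Cesàro operator $\mathsf{C}\colon C_l([0,\infty])\to C_l([0,\infty])$ is not supercyclic.
   Context: $C_l([0,\infty])$ is the Banach space of all $\mathbb{C}$-valued continuous functions $f$ on $[0,\infty)$ for which $\lim_{x\to\infty}f(x)$ exists in $\mathbb{C}$, equipped with the sup-norm. The continuous Cesàro operator is $\mathsf{C}f(x):=\frac1x\int_0^x f(t)\,dt$ for $x\in(0,\infty)$, with $\mathsf{C}f(0):=f(0)$; it maps $C_l([0,\infty])$ into itself. A bounded linear operator $T$ on a separable Banach space $X$ is supercyclic if there is $x\in X$ such that $\{\lambda T^nx\colon \lambda\in\mathbb{C},\ n\in\mathbb{N}_0\}$ is dense in $X$. *)

(* Defs.v *)
From HB Require Import structures.
From mathcomp Require Import all_boot all_order all_algebra.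
From mathcomp Require Import all_classical all_reals all_analysis.
From mathcomp Require Import complex.
From mathcomp Require Import ring lra.
Import Order.TTheory GRing.Theory Num.Theory.
Import numFieldNormedType.Exports.
Import Normc.

Set Implicit Arguments.
Unset Strict Implicit.
Unset Printing Implicit Defensive.

Local Open Scope classical_set_scope.
Local Open Scope ring_scope.
Local Open Scope complex_scope.

Section ComplexTopology.
Context {R : realType}.
Local Notation C := (R[i]^o).
Implicit Types z : R[i].

Lemma normcE' z : `|z| = (normc z)%:C. Proof. by []. Qed.

Lemma normc_ge0 z : 0 <= normc z.
Proof. by rewrite -ler0c -normcE'. Qed.

Lemma Re_le_normc z : `|complex.Re z| <= normc z.
Proof. by rewrite -lecR -normcE' normc_ge_Re. Qed.

Lemma Im_le_normc z : `|complex.Im z| <= normc z.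
Proof.
by case: z => a b /=; rewrite -sqrtr_sqr ler_sqrt ?addr_ge0 ?sqr_ge0// lerDr sqr_ge0.
Qed.

Lemma normc_le_ReIm z : normc z <= `|complex.Re z| + `|complex.Im z|.
Proof.
case: z => a b /=; rewrite -[leRHS]ger0_norm ?addr_ge0// -sqrtr_sqr.
rewrite ler_sqrt ?sqr_ge0// sqrrD !real_normK ?num_real//.
by rewrite addrAC lerDl mulrn_wge0 ?mulr_ge0.
Qed.

Lemma normc_distC z1 z2 : normc (z1 - z2) = normc (z2 - z1).
Proof. by rewrite -opprB normcN. Qed.

Lemma cvgc_normc {T : Type} {F : set_system T} {FF : Filter F} (u : T -> C) (l : C) :
  u @ F --> l <-> forall e : R, 0 < e -> \forall t \near F, normc (l - u t) < e.
Proof.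
split=> [/cvgrPdist_lt h e e0|h].
  have := h e%:C; rewrite ltcR => /(_ e0); apply: filterS => t.
  by rewrite normcE' ltcR.
apply/cvgrPdist_lt => -[a b]; rewrite ltcE /= => /andP[/eqP-> a0].
by have := h a a0; apply: filterS => t; rewrite -ltcR.
Qed.

Lemma cvgc_ReIm {T : Type} {F : set_system T} {FF : Filter F} (u : T -> C) (l : C) :
  u @ F --> l <->
  (complex.Re (u t) @[t --> F] --> complex.Re l /\
   complex.Im (u t) @[t --> F] --> complex.Im l).
Proof.
split=> [/cvgc_normc h|[/cvgrPdist_lt h1 /cvgrPdist_lt h2]].
  split; apply/cvgrPdist_lt => e e0; have := h e e0; apply: filterS => t;
    apply: le_lt_trans; [have := Re_le_normc (l - u t)|have := Im_le_normc (l - u t)];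
    by case: l (u t) {h} => ? ? [? ?].
apply/cvgc_normc => e e0; have e2 : 0 < e / 2 by rewrite divr_gt0.
have := h2 _ e2; have := h1 _ e2; apply: filterS2 => t.
move=> r1 r2; apply: le_lt_trans (normc_le_ReIm _) _.
rewrite [e]splitr; apply: ltrD; move: r1 r2; by case: l (u t) {h1 h2} => ? ? [? ?].
Qed.

Lemma complete_complex (F : set_system C) : ProperFilter F -> cauchy F -> cvg F.
Proof.
move=> FF /cauchyP Fc.
have G (p : R[i] -> R) : (forall z1 z2, `|p z1 - p z2| <= normc (z1 - z2)) ->
    cvg (p z @[z --> F]).
  move=> pl; apply: R_complete; apply/cauchyP => e e0.
  have /Fc[z zF] : 0 < e%:C by rewrite ltcR.
  exists (p z); rewrite /nbhs/=; apply: filterS zF => y; rewrite /ball/= normcE' ltcR.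
  by apply: le_lt_trans; exact: pl.
have /cvg_ex[a Fa] : cvg (complex.Re z @[z --> F]).
  by apply: G => -[a b] [c d]; exact: (Re_le_normc (_ +i* _)).
have /cvg_ex[b Fb] : cvg (complex.Im z @[z --> F]).
  by apply: G => -[c d] [a' d']; exact: (Im_le_normc (_ +i* _)).
by apply/cvg_ex; exists (a +i* b); apply/(@cvgc_ReIm _ F _ id).
Qed.

End ComplexTopology.

Section RealAverage.
Context {R : realType}.
Notation mu := (@lebesgue_measure R).
Implicit Types (f g : R -> R) (a b c e x : R).

Definition avg g x := if 0 < x then x^-1 * \int[mu]_(t in `[0, x]) g t else g x.

Lemma within_itv_integrable g a b : 0 <= a ->
  {within `[0, +oo[, continuous g} -> mu.-integrable `[a, b] (EFin \o g).
Proof.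
move=> a0 gc; apply: continuous_compact_integrable; first exact: segment_compact.
apply: continuous_subspaceW gc => x /=; rewrite !in_itv/= andbT => /andP[ax _].
exact: le_trans ax.
Qed.

Lemma Rintegral_itv_split g a x : 0 <= a -> a <= x ->
  {within `[0, +oo[, continuous g} ->
  \int[mu]_(t in `[0, x]) g t =
  \int[mu]_(t in `[0, a]) g t + \int[mu]_(t in `[a, x]) g t.
Proof.
move=> a0 ax gc.
rewrite -(@Rintegral_itv_obnd_cbnd _ a (BRight x)); last first.
  apply: integrableS (within_itv_integrable x a0 gc) => //.
  by apply: subset_itvr; rewrite bnd_simp.
rewrite -(@Rintegral_itvB _ _ (BLeft 0) (BRight x) a) ?bnd_simp//; last first.
  exact: within_itv_integrable.
by rewrite addrC subrK.
Qed.

Lemma Rintegral_itv_cst a x c : a <= x ->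
  \int[mu]_(t in `[a, x]) c = (x - a) * c.
Proof.
move=> ax; rewrite Rintegral_cst//= lebesgue_measure_itv/= lte_fin.
move: ax; rewrite le_eqVlt => /predU1P[->|->]; last by rewrite mulrC.
by rewrite ltxx subrr mul0r mulr0.
Qed.

Lemma Rintegral_itv_dist g a c e x : 0 <= a -> a <= x ->
  {within `[0, +oo[, continuous g} ->
  (forall t, a <= t <= x -> `|g t - c| <= e) ->
  `|\int[mu]_(t in `[a, x]) g t - (x - a) * c| <= (x - a) * e.
Proof.
move=> a0 ax gc h; rewrite -!Rintegral_itv_cst//.
have ic r : mu.-integrable `[a, x] (EFin \o cst r).
  by apply: continuous_compact_integrable;
    [exact: segment_compact|apply: continuous_subspaceT => ?; exact: cvg_cst].
have ig := within_itv_integrable x a0 gc.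
have igc : mu.-integrable `[a, x] (EFin \o (fun t => g t - c)).
  have := integrableB _ ig (ic c) => /(_ (measurable_itv _)).
  by apply: eq_integrable.
rewrite -RintegralB//; last exact: ic.
apply: le_trans; first by apply: le_normr_Rintegral igc; exact: measurable_itv.
apply: le_Rintegral => //.
- exact: (integrable_abse igc).
- exact: ic.
Qed.

Lemma avg_continuous g : {within `[0, +oo[, continuous g} ->
  {within `[0, +oo[, continuous (avg g)}.
Proof.
move=> gc; apply/continuous_within_itvcyP; split.
  move=> x; rewrite in_itv/= andbT => x0.
  have x1 : 0 < x + 1 by rewrite addr_gt0.
  have /(continuous_within_itvP _ x1)[Fc _ _] :=
    parameterized_integral_continuous (ltW x1) (within_itv_integrable (x + 1) (lexx 0) gc).
  have : (y^-1 * parameterized_integral mu 0 y g) @[y --> x] --> avg g x.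
    rewrite /avg x0; apply: cvgM; first by apply: cvgV; [rewrite gt_eqF|exact: cvg_id].
    by apply: Fc; rewrite in_itv/= x0 ltrDl ltr01.
  apply: cvg_trans; apply: near_eq_cvg; near=> y.
  by rewrite /avg; have -> : 0 < y by near: y; exact: lt_nbhsr.
have [_ g0] := (continuous_within_itvcyP _ _).1 gc.
have -> : avg g 0 = g 0 by rewrite /avg ltxx.
apply/cvgrPdist_le => e e0.
have [d /= d0 hd] := (cvgrPdist_le _ _).1 g0 e e0.
exists d => //= x /=; rewrite sub0r normrN => xd x0; rewrite /avg x0.
rewrite distrC -(ler_pM2l x0) -[X in X * `| _ |](gtr0_norm x0) -normrM mulrBr.
rewrite mulVKf ?gt_eqF// -[X in X * g 0]subr0 -[X in X * e]subr0.
apply: Rintegral_itv_dist => //; first exact: ltW.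
move=> t /andP[]; rewrite le_eqVlt => /predU1P[<- _|t0 tx].
  by rewrite subrr normr0 ltW.
rewrite distrC; apply: hd => //=.
by rewrite sub0r normrN gtr0_norm// (le_lt_trans tx)// -(gtr0_norm x0).
Unshelve. all: by end_near. Qed.

Lemma avg_cvgy g (L : R) : {within `[0, +oo[, continuous g} ->
  g x @[x --> +oo] --> L -> avg g x @[x --> +oo] --> L.
Proof.
move=> gc /cvgrPdist_le gL; apply/cvgrPdist_le => e e0; have e2 : 0 < e / 2 by rewrite divr_gt0.
have [M [_ hM]] := gL _ e2.
pose N := `|M| + 1; have N0 : 0 < N by rewrite ltr_wpDl.
have hN t : N <= t -> `|g t - L| <= e / 2.
  move=> Nt; rewrite distrC; apply: hM; apply: lt_le_trans Nt.
  by rewrite /N ltr_pwDr// ler_norm.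
pose K := `|\int[mu]_(t in `[0, N]) g t - N * L|.
near=> x.
have Nx : N <= x by near: x; apply: nbhs_pinfty_ge; exact: num_real.
have x0 : 0 < x by exact: lt_le_trans Nx.
have Kx : K / (e / 2) <= x by near: x; apply: nbhs_pinfty_ge; exact: num_real.
rewrite /avg x0.
rewrite distrC -(ler_pM2l x0) -[X in X * `| _ |](gtr0_norm x0) -normrM mulrBr.
rewrite mulVKf ?gt_eqF// (Rintegral_itv_split (ltW N0) Nx gc).
have -> : \int[mu]_(t in `[0, N]) g t + \int[mu]_(t in `[N, x]) g t - x * L =
  (\int[mu]_(t in `[0, N]) g t - N * L) + (\int[mu]_(t in `[N, x]) g t - (x - N) * L).
  by ring.
rewrite (le_trans (ler_normD _ _))// [leRHS](_ : _ = x * (e / 2) + x * (e / 2)); last first.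
  by field.
rewrite lerD//; first by rewrite -ler_pdivrMr.
apply: le_trans (Rintegral_itv_dist (ltW N0) Nx gc _) _.
  by move=> t /andP[Nt _]; exact: hN.
by rewrite ler_pM2r// lerBlDr lerDl ltW.
Unshelve. all: by end_near. Qed.

Lemma avgD f g x : {within `[0, +oo[, continuous f} ->
  {within `[0, +oo[, continuous g} -> avg (fun t => f t + g t) x = avg f x + avg g x.
Proof.
move=> fc gc; rewrite /avg; case: ifP => // x0.
have fi := within_itv_integrable x (lexx 0) fc.
have gi := within_itv_integrable x (lexx 0) gc.
rewrite -mulrDr; congr (_ * _).
by apply: (RintegralD _ fi gi); exact: measurable_itv.
Qed.

Lemma avgZ c g x : {within `[0, +oo[, continuous g} ->
  avg (fun t => c * g t) x = c * avg g x.
Proof.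
move=> gc; rewrite /avg; case: ifP => // x0.
have gi := within_itv_integrable x (lexx 0) gc.
rewrite [RHS]mulrCA; congr (_ * _).
by apply: (RintegralZl c _ gi); exact: measurable_itv.
Qed.

Lemma avg_bound g x e : {within `[0, +oo[, continuous g} -> 0 <= x ->
  (forall t, 0 <= t -> `|g t| <= e) -> `|avg g x| <= e.
Proof.
move=> gc x0 h; rewrite /avg; case: ifPn => [{}x0|_]; last exact: h.
rewrite normrM gtr0_norm ?invr_gt0// ler_pdivrMl//.
have := @Rintegral_itv_dist g 0 0 e x (lexx 0) (ltW x0) gc.
by rewrite mulr0 !subr0; apply=> t /andP[t0 _]; rewrite subr0 h.
Qed.

End RealAverage.

Section ContinuousLimit.
Context {R : realType}.
Notation C := (R[i]^o).
Implicit Types (f g : R -> C) (x e : R).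

(* A complex function on [0, +oo[ is encoded by its extension by 0 to the
   negative half-line, so that equality in C_l below is equality on [0, +oo[;
   continuity is only required on [0, +oo[ (one-sided at 0). *)
Definition has_C_l f : Prop :=
  [/\ {within `[0, +oo[, continuous f},
      exists l : C, f x @[x --> +oo] --> l
    & forall x, x < 0 -> f x = 0].

Definition C_l_pred : {pred R -> C} := [pred f | `[< has_C_l f >]].

Lemma C_l_predP f : reflect (has_C_l f) (f \in C_l_pred).
Proof. exact: asboolP. Qed.

Lemma C_l_submod_closed : submod_closed C_l_pred.
Proof.
split=> [|a f g /C_l_predP[fc [lf fl] f0] /C_l_predP[gc [lg gl] g0]];
  apply/C_l_predP; split.
- by move=> x; exact: cvg_cst.
- by exists 0; exact: cvg_cst.
- by [].
- by move=> x; apply: cvgD; [apply: cvgZr|]; [exact: fc|exact: gc].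
- by exists (a *: lf + lg); apply: cvgD; [apply: cvgZr; exact: fl|exact: gl].
- by move=> x x0; rewrite /= !fctE f0// g0// scaler0 addr0.
Qed.

HB.instance Definition _ :=
  GRing.isSubmodClosed.Build R[i] (R -> C) C_l_pred C_l_submod_closed.

End ContinuousLimit.

Record C_l (R : realType) := MkC_l {
  C_l_fun :> R -> R[i]^o ;
  C_l_subproof : C_l_fun \in C_l_pred }.

HB.instance Definition _ (R : realType) := [isSub for @C_l_fun R].
HB.instance Definition _ (R : realType) := [Choice of C_l R by <:].
HB.instance Definition _ (R : realType) := [SubChoice_isSubLmodule of C_l R by <:].

Section C_l_theory.
Context {R : realType}.
Notation C := (R[i]^o).
Implicit Types (f g : C_l R) (x e : R).

Lemma C_lP f : has_C_l f. Proof. exact/C_l_predP/C_l_subproof. Qed.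

Lemma C_l_eq f g : (forall x, 0 <= x -> f x = g x) -> f = g.
Proof.
move=> fg; apply/val_inj/funext => x /=; have [/fg//|x0] := leP 0 x.
by have [_ _ ->//] := C_lP f; have [_ _ ->] := C_lP g.
Qed.

Lemma C_lDE f g x : (f + g) x = f x + g x. Proof. by []. Qed.
Lemma C_lBE f g x : (f - g) x = f x - g x. Proof. by []. Qed.
Lemma C_lZE (a : R[i]) f x : (a *: f) x = a * f x. Proof. by []. Qed.
Lemma C_l0E x : (0 : C_l R) x = 0. Proof. by []. Qed.

Lemma normc_cvg {T : Type} {F : set_system T} {FF : Filter F} (u : T -> C) (l : C) :
  u @ F --> l -> normc (u t) @[t --> F] --> normc l.
Proof.
move=> /cvgc_normc h; apply/cvgrPdist_lt => e e0; have := h e e0.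
apply: filterS => t; apply: le_lt_trans.
rewrite ler_norml; apply/andP; split.
  rewrite lerNl opprB lerBlDr normc_distC (le_trans _ (le_normcD _ _))// subrK//.
by rewrite lerBlDr (le_trans _ (le_normcD _ _))// subrK.
Qed.

Lemma C_l_has_sup f : has_sup [set normc (f x) | x in `[0, +oo[].
Proof.
split; first by exists (normc (f 0)), 0 => //=; rewrite in_itv/= lexx.
have [fc [l fl] _] := C_lP f.
have /cvgc_normc/(_ 1 ltr01)[M [_ hM]] := fl.
pose N := `|M| + 1; have N0 : 0 <= N by rewrite addr_ge0.
have nc : {within `[0, +oo[, continuous (fun x : R => normc (f x) : R)}.
  by move=> x; apply: normc_cvg; exact: fc.
have : {within `[0, N], continuous (fun x : R => normc (f x) : R)}.
  apply: continuous_subspaceW nc => x /=.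
  by rewrite !in_itv/= andbT => /andP[].
move=> /(EVT_max N0)[c _ hc].
exists (Num.max (normc (f c)) (normc l + 1)) => _ [x /= + <-].
rewrite in_itv/= andbT => x0; rewrite le_max; have [xN|Nx] := leP x N.
  by rewrite hc// in_itv/= x0.
apply/orP; right; have : normc (l - f x) < 1.
  by apply: hM; rewrite (lt_trans _ Nx)// /N ltr_pwDr// ler_norm.
rewrite normc_distC => h; rewrite -[f x](subrK l) (le_trans (le_normcD _ _))//.
by rewrite addrC lerD2l ltW.
Qed.

(* normc z is the modulus of z as an element of R, whereas `|z| : R[i]. *)
Definition sup_norm f : R := sup [set normc (f x) | x in `[0, +oo[].

Lemma sup_norm_ub f x : 0 <= x -> normc (f x) <= sup_norm f.
Proof.
move=> x0; apply: sup_upper_bound; first exact: C_l_has_sup.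
by exists x => //=; rewrite in_itv/= x0.
Qed.

Lemma sup_norm_le f e : (forall x, 0 <= x -> normc (f x) <= e) -> sup_norm f <= e.
Proof.
move=> h; apply: ge_sup; first by have [] := C_l_has_sup f.
by move=> _ [x /= + <-]; rewrite in_itv/= andbT; exact: h.
Qed.

Lemma sup_normD f g : (sup_norm (f + g))%:C <= (sup_norm f)%:C + (sup_norm g)%:C.
Proof.
rewrite -rmorphD/= lecR; apply: sup_norm_le => x x0.
by rewrite (le_trans (le_normcD _ _))// lerD// sup_norm_ub.
Qed.

Lemma sup_normZ (a : R[i]) f : (sup_norm (a *: f))%:C = `|a| * (sup_norm f)%:C.
Proof.
rewrite normcE' -rmorphM/=; congr (_%:C); apply/eqP; rewrite eq_le; apply/andP; split.
  apply: sup_norm_le => x x0.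
  by rewrite C_lZE normcM ler_wpM2l ?normc_ge0 ?sup_norm_ub.
have [->|a0] := eqVneq a 0.
  by rewrite normc0 mul0r (le_trans (normc_ge0 _) (sup_norm_ub _ (lexx 0))).
have na0 : 0 < normc a.
  by rewrite lt_neqAle normc_ge0 andbT eq_sym; apply: contra a0 => /eqP/eq0_normc ->.
rewrite -ler_pdivlMl//; apply: sup_norm_le => x x0.
by rewrite ler_pdivlMl// -normcM -C_lZE sup_norm_ub.
Qed.

Lemma sup_norm_eq0 f : (sup_norm f)%:C = 0 -> f = 0.
Proof.
move=> [/eqP f0]; apply: C_l_eq => x x0; apply: eq0_normc; apply/eqP.
by rewrite eq_le normc_ge0 andbT -(eqP f0) sup_norm_ub.
Qed.

End C_l_theory.

HB.instance Definition _ (R : realType) := @Lmodule_isNormed.Build R[i] (C_l R)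
  (fun f => (sup_norm f)%:C) sup_normD sup_normZ sup_norm_eq0.

Lemma C_l_normE (R : realType) (f : C_l R) : `|f| = (sup_norm f)%:C.
Proof. by []. Qed.

Section C_l_complete.
Context {R : realType}.
Notation C := (R[i]^o).

Lemma C_l_complete_axiom (F : set_system (C_l R)) :
  ProperFilter F -> cauchy F -> cvg F.
Proof.
move=> FF /cauchyP Fc.
have Fe (e : R) : 0 < e ->
    exists f : C_l R, F (ball f e%:C).
  by move=> e0; have [f Ff] := Fc e%:C ltac:(by rewrite ltcR); exists f.
have ballE (f g : C_l R) (e x : R) : 0 <= x -> ball f e%:C g -> normc (f x - g x) < e.
  move=> x0; rewrite -ball_normE /ball_/= C_l_normE ltcR; apply: le_lt_trans.
  exact: (sup_norm_ub (f - g)).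
have Fx (x : R) : 0 <= x -> cvg ((fun f : C_l R => f x : C) @ F).
  move=> x0; apply: complete_complex; apply/cauchyP => e e0.
  have [f Ff] := Fc e e0; exists (f x : C); rewrite /nbhs/=; apply: filterS Ff => g.
  move: e0; case: e => a b; rewrite ltcE/= => /andP[/eqP-> a0] fg.
  by rewrite /ball/= normcE' ltcR; exact: (ballE f g a).
pose h (x : R) : C := if 0 <= x then lim ((fun f : C_l R => f x : C) @ F) else 0.
have hE (e : R) (f : C_l R) : 0 < e -> F (ball f e%:C) ->
    forall x : R, 0 <= x -> normc (f x - h x) <= e.
  move=> e0 Ff x x0; rewrite /h x0; apply/ler_addgt0Pr => d d0.
  have /cvgc_normc/(_ d d0) lx := Fx x x0.
  near F => g.
  have -> : f x - lim ((fun f : C_l R => f x : C) @ F) =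
    (f x - g x) - (lim ((fun f : C_l R => f x : C) @ F) - g x) by ring.
  rewrite (le_trans (le_normcD _ _))// normcN lerD//; apply: ltW.
    by apply: (ballE f g e) => //; near: g.
  by near: g.
have appr (e : R) : 0 < e -> exists f : C_l R, forall x : R, 0 <= x -> normc (f x - h x) <= e.
  by move=> e0; have [f Ff] := Fe e e0; exists f; exact: hE.
have hC : h \in C_l_pred.
  apply/C_l_predP; split.
  - apply/subspace_continuousP => x x0; apply/cvgc_normc => e e0.
    have e3 : 0 < e / 3 by rewrite divr_gt0.
    have [f hf] := appr _ e3; have [fc _ _] := C_lP f.
    have /cvgc_normc/(_ _ e3) := (subspace_continuousP _ _).1 fc x x0.
    apply: filterS2 (withinT _ _) => y y0 fy.
    move: x0 y0 => /=; rewrite !in_itv/= !andbT => x0 y0.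
    have -> : h x - h y = (f x - f y) - (f x - h x) + (f y - h y) by ring.
    rewrite (le_lt_trans (le_normcD _ _))//.
    rewrite (_ : e = e / 3 + e / 3 + e / 3); last by field.
    rewrite ltr_leD ?hf// (le_lt_trans (le_normcD _ _))// normcN ltr_leD ?hf//.
  - suff /cvg_ex : cvg ((h x : C) @[x --> +oo]) by [].
    apply: complete_complex; apply/cauchyP => -[e d]; rewrite ltcE/= => /andP[/eqP-> {d} e0].
    have e3 : 0 < e / 3 by rewrite divr_gt0.
    have [f hf] := appr _ e3; have [_ [l fl] _] := C_lP f.
    exists l; have /cvgc_normc/(_ _ e3) fl' := fl.
    rewrite /nbhs/=; near=> x.
    have x0 : 0 <= x by near: x; apply: nbhs_pinfty_ge; exact: num_real.
    rewrite /ball/= normcE' ltcR.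
    have -> : l - h x = (l - f x) + (f x - h x) by ring.
    rewrite (le_lt_trans (le_normcD _ _))// (@lt_le_trans _ _ (e / 3 + e / 3))//.
      by rewrite ltr_leD ?hf//; near: x.
    lra.
  - by move=> x; rewrite /h ltNge => /negbTE->.
pose H := MkC_l hC; apply/cvg_ex; exists H; apply/cvgrPdist_lt => -[e d].
rewrite ltcE/= => /andP[/eqP-> {d} e0].
have e3 : 0 < e / 3 by rewrite divr_gt0.
have [f Ff] := Fe _ e3; apply: (filterS _ (Ff)) => g fg; rewrite C_l_normE ltcR.
apply: (@le_lt_trans _ _ (e / 3 + e / 3)); last by lra.
apply: sup_norm_le => x x0; rewrite C_lBE.
have -> : H x - g x = (f x - g x) - (f x - h x) by rewrite /=; ring.
rewrite (le_trans (le_normcD _ _))// normcN lerD//; [apply: ltW; exact: (ballE f g)|exact: (hE _ f e3 Ff)].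
Unshelve. all: by end_near. Qed.

End C_l_complete.

HB.instance Definition _ (R : realType) :=
  Uniform_isComplete.Build (C_l R) (@C_l_complete_axiom R).

Section Cesaro.
Context {R : realType}.
Notation C := (R[i]^o).
Notation mu := (@lebesgue_measure R).
Implicit Types (f g : C_l R) (x e : R).

(* The integral of a complex function, componentwise for Lebesgue measure. *)
Definition cintegral (D : set R) (u : R -> C) : C :=
  (\int[mu]_(t in D) complex.Re (u t)) +i* (\int[mu]_(t in D) complex.Im (u t)).

(* The second branch gives u 0 at x = 0, and preserves u x = 0 for x < 0. *)
Definition cesaro_fun (u : R -> C) : R -> C := fun x =>
  if 0 < x then (x^-1)%:C * cintegral `[0, x] u else u x.

Lemma Re_cesaro_fun u x :
  complex.Re (cesaro_fun u x) = avg (fun t => complex.Re (u t)) x.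
Proof. by rewrite /cesaro_fun /avg; case: ifP => //= _; rewrite mul0r subr0. Qed.

Lemma Im_cesaro_fun u x :
  complex.Im (cesaro_fun u x) = avg (fun t => complex.Im (u t)) x.
Proof. by rewrite /cesaro_fun /avg; case: ifP => //= _; rewrite mul0r addr0. Qed.

Lemma Re_cesaro_funE u :
  (fun x => complex.Re (cesaro_fun u x)) = avg (fun t => complex.Re (u t)).
Proof. by apply/funext => x; exact: Re_cesaro_fun. Qed.

Lemma Im_cesaro_funE u :
  (fun x => complex.Im (cesaro_fun u x)) = avg (fun t => complex.Im (u t)).
Proof. by apply/funext => x; exact: Im_cesaro_fun. Qed.

Lemma C_l_Re f : {within `[0, +oo[, continuous (fun x => complex.Re (f x) : R)}.
Proof.
by have [fc _ _] := C_lP f; move=> x; have /cvgc_ReIm[] := fc x.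
Qed.

Lemma C_l_Im f : {within `[0, +oo[, continuous (fun x => complex.Im (f x) : R)}.
Proof.
by have [fc _ _] := C_lP f; move=> x; have /cvgc_ReIm[] := fc x.
Qed.

Lemma cesaro_fun_cvgy f (l : C) :
  f x @[x --> +oo] --> l -> cesaro_fun f x @[x --> +oo] --> l.
Proof.
move=> /cvgc_ReIm[fr fi]; apply/cvgc_ReIm; split.
  rewrite Re_cesaro_funE.
  by apply: avg_cvgy fr; exact: C_l_Re.
rewrite Im_cesaro_funE.
by apply: avg_cvgy fi; exact: C_l_Im.
Qed.

Lemma cesaro_subproof f : cesaro_fun f \in C_l_pred.
Proof.
have [_ [l fl] f0] := C_lP f; apply/C_l_predP; split.
- move=> x; apply/cvgc_ReIm; split.
    by rewrite Re_cesaro_funE Re_cesaro_fun; exact: (avg_continuous (@C_l_Re f)).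
  by rewrite Im_cesaro_funE Im_cesaro_fun; exact: (avg_continuous (@C_l_Im f)).
- by exists l; exact: cesaro_fun_cvgy.
- by move=> x x0; rewrite /cesaro_fun ltNge (ltW x0)/= f0.
Qed.

Definition cesaro_op f : C_l R := MkC_l (cesaro_subproof f).

Lemma cesaro0E f : cesaro_op f 0 = f 0.
Proof. by rewrite /= /cesaro_fun ltxx. Qed.

Lemma cesaro_gt0E f x : 0 < x -> cesaro_op f x = (x^-1)%:C * cintegral `[0, x] f.
Proof. by move=> x0; rewrite /= /cesaro_fun x0. Qed.

Lemma cesaro_is_linear : linear cesaro_op.
Proof.
move=> a f g; apply: C_l_eq => x x0; rewrite C_lDE C_lZE.
have cZ (b : R) (u : R -> R) : {within `[0, +oo[, continuous u} ->
    {within `[0, +oo[, continuous (fun t => b * u t)}.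
  by move=> uc y; apply: cvgM; [exact: cvg_cst|exact: uc].
have cD (u v : R -> R) : {within `[0, +oo[, continuous u} ->
    {within `[0, +oo[, continuous v} -> {within `[0, +oo[, continuous (fun t => u t + v t)}.
  by move=> uc vc y; apply: cvgD; [exact: uc|exact: vc].
have [fr fi] := (@C_l_Re f, @C_l_Im f).
have [gr gi] := (@C_l_Re g, @C_l_Im g).
apply/eqP; rewrite eq_complex; apply/andP; split; apply/eqP.
  transitivity (complex.Re a * complex.Re (cesaro_op f x) +
    (- complex.Im a) * complex.Im (cesaro_op f x) + complex.Re (cesaro_op g x)); last first.
    by case: a (cesaro_op f x) (cesaro_op g x) => ? ? [? ?] [? ?] /=; rewrite mulNr.
  rewrite /= !Re_cesaro_fun Im_cesaro_fun -(avgZ _ _ fr) -(avgZ _ _ fi).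
  rewrite -(avgD _ (cZ _ _ fr) (cZ _ _ fi)) -(avgD _ (cD _ _ (cZ _ _ fr) (cZ _ _ fi)) gr).
  congr (avg _ x); apply/funext => t; rewrite -[LHS]/(complex.Re (a * f t + g t)).
  by case: a (f t) (g t) => ? ? [? ?] [? ?] /=; rewrite mulNr.
transitivity (complex.Re a * complex.Im (cesaro_op f x) +
    complex.Im a * complex.Re (cesaro_op f x) + complex.Im (cesaro_op g x)); last first.
  by case: a (cesaro_op f x) (cesaro_op g x) => ? ? [? ?] [? ?] /=.
rewrite /= !Im_cesaro_fun Re_cesaro_fun -(avgZ _ _ fr) -(avgZ _ _ fi).
rewrite -(avgD _ (cZ _ _ fi) (cZ _ _ fr)) -(avgD _ (cD _ _ (cZ _ _ fi) (cZ _ _ fr)) gi).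
congr (avg _ x); apply/funext => t; rewrite -[LHS]/(complex.Im (a * f t + g t)).
by case: a (f t) (g t) => ? ? [? ?] [? ?] /=.
Qed.

HB.instance Definition _ :=
  GRing.isLinear.Build R[i] (C_l R) (C_l R) *:%R cesaro_op cesaro_is_linear.

Lemma cesaro_continuous : continuous cesaro_op.
Proof.
apply/linear_bounded_continuous/linear_boundedP; near=> r => f.
suff h : `|cesaro_op f| <= 2 * `|f|.
  by rewrite (le_trans h)// ler_wpM2r//; near: r; exact: nbhs_pinfty_ge.
rewrite !C_l_normE -[2]/(2%:R) -(rmorph_nat (real_complex R)) -rmorphM/= lecR.
apply: sup_norm_le => x x0; rewrite mulr_natl mulr2n.
rewrite (le_trans (normc_le_ReIm _))//= Re_cesaro_fun Im_cesaro_fun lerD//.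
  apply: avg_bound x0 _ => [|t t0]; first exact: C_l_Re.
  by rewrite (le_trans (Re_le_normc _))// sup_norm_ub.
apply: avg_bound x0 _ => [|t t0]; first exact: C_l_Im.
by rewrite (le_trans (Im_le_normc _))// sup_norm_ub.
Unshelve. all: by end_near. Qed.

End Cesaro.

(* {linear X -> X} does not bundle boundedness: for cesaro_op it is
   cesaro_continuous (see linear_bounded_continuous). Separability of X is not
   required here, as it follows from the existence of such an x. *)
Definition supercyclic (R : realType) (X : completeNormedModType R[i])
    (T : {linear X -> X}) : Prop :=
  exists x : X, dense [set y | exists (a : R[i]) (n : nat), y = a *: iter n T x].

(* Main.v *)
(** Both [f 0] and the limit of [f] at infinity are preserved by the Cesàro
    operator, so the pair of boundary values of a multiple of [C^n f] is a
    multiple of that of [f]: the projective orbit of [f] approximates at most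
    one direction of boundary values, e.g. not both (1, 1) and (1, 0). *)
Require Import Defs.
From mathcomp Require Import all_boot all_order all_algebra.
From mathcomp Require Import all_classical all_reals all_analysis.
From mathcomp Require Import complex.
From mathcomp Require Import lra.
Import Order.TTheory GRing.Theory Num.Theory.
Import numFieldNormedType.Exports.
Import Normc.

Set Implicit Arguments.
Unset Strict Implicit.
Unset Printing Implicit Defensive.

Local Open Scope classical_set_scope.
Local Open Scope ring_scope.
Local Open Scope complex_scope.

Section BoundaryValues.
Context {R : realType}.
Notation C := (R[i]^o).
Implicit Types f g : C_l R.

Lemma C_l_boundary_values (u v : R) :
  exists2 g : C_l R, g 0 = u%:C & (g x : C) @[x --> +oo] --> (v%:C : C).
Proof.
(* Affine ramp from [u] at 0 to [v] at 1, constant beyond 1, so the limit at infinity is already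
   attained. *)
pose r (x : R) : R := (u - v) * Num.max 0 (1 - x) + v.
have rc : continuous r.
  move=> x; apply: cvgD; last exact: cvg_cst.
  apply: cvgM; first exact: cvg_cst.
  have : {for x, continuous ((fun=> 0 : R^o) \max (fun y : R => 1 - y : R^o))}.
    by apply: continuous_max; [|apply: cvgB; [|exact: cvg_id]]; exact: cvg_cst.
  exact.
pose h (x : R) : C := if 0 <= x then (r x)%:C else 0.
have hl : h x @[x --> +oo] --> (v%:C : C).
  apply: (@cvg_trans _ ((fun=> v%:C : C) @ +oo)); last exact: cvg_cst.
  apply: near_eq_cvg; near=> x.
  have x1 : 1 <= x by near: x; apply: nbhs_pinfty_ge; exact: num_real.
  by rewrite /h (le_trans ler01 x1) /r max_l ?subr_le0// mulr0 add0r.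
have hC : h \in C_l_pred.
  apply/C_l_predP; split; last by move=> x; rewrite /h ltNge => /negbTE->.
    (* The extension [h] by 0 may jump at 0, but on the closed half-line it agrees with the ramp,
       which is continuous on the whole line. *)
    apply: (@subspace_eq_continuous _ _ _ (fun x => (r x)%:C : C)).
      move=> x; rewrite inE/= in_itv/= andbT => x0.
      by rewrite /from_subspace /h x0.
    apply: continuous_subspaceT => x; apply/cvgc_ReIm; split => /=.
      exact: rc.
    exact: cvg_cst.
  by exists v%:C.
exists (MkC_l hC) => //=.
by rewrite /h lexx /r subr0 max_r ?ler01// mulr1 subrK.
Unshelve. all: by end_near. Qed.

(** Evaluation at infinity is thus a functional of norm at most 1, like evaluation at a point. *)
Lemma normc_lim_le_sup_norm f (l : C) :
  (f x : C) @[x --> +oo] --> l -> normc l <= sup_norm f.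
Proof.
move=> /normc_cvg fl; apply: (@cvgr_to_le _ _ _ _ (fun x => normc (f x))) fl _.
near=> x; apply: sup_norm_ub.
by near: x; apply: nbhs_pinfty_ge; exact: num_real.
Unshelve. all: by end_near. Qed.

Lemma iter_cesaro_op0 f n : iter n (@cesaro_op R) f 0 = f 0.
Proof. by elim: n => //= n <-; exact: cesaro0E. Qed.

Lemma iter_cesaro_op_cvgy f n (l : C) : (f x : C) @[x --> +oo] --> l ->
  (iter n (@cesaro_op R) f x : C) @[x --> +oo] --> l.
Proof. by move=> fl; elim: n => //= n; exact: cesaro_fun_cvgy. Qed.

(** An orbit element [e]-close in norm to a function with boundary values [u], [v] has boundary
    values [e]-close to these; its own are [a * f 0] and [a * l], whatever the iterate [n]. *)
Lemma dense_cesaro_orbit_boundary f (l : C) (u v e : R) :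
  dense [set y | exists (a : R[i]) n, y = a *: iter n (@cesaro_op R) f] ->
  (f x : C) @[x --> +oo] --> l -> 0 < e ->
  exists a : R[i], normc (u%:C - a * f 0) < e /\ normc (v%:C - a * l) < e.
Proof.
move=> fd fl e0; have [g g0 gv] := C_l_boundary_values u v.
have e0' : (0 : R[i]) < e%:C by rewrite ltcR.
have [||y [gy [a [n yE]]]] := fd (ball g e%:C).
- by exists g; exact: ballxx.
- exact: ball_open.
move: gy; rewrite -ball_normE /ball_/= C_l_normE ltcR {}yE => ge.
exists a; split; apply: le_lt_trans ge.
  have := sup_norm_ub (g - a *: iter n (@cesaro_op R) f) (lexx 0).
  by rewrite C_lBE C_lZE iter_cesaro_op0 g0.
apply: normc_lim_le_sup_norm.
have nl := @iter_cesaro_op_cvgy f n l fl.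
exact: (cvgB gv (cvgZl_tmp (k := a) nl)).
Qed.

End BoundaryValues.

Theorem proposition2p9 (R : realType) :
  ~ supercyclic (@cesaro_op R : {linear C_l R -> C_l R}).
Proof.
move=> [f fd]; have [_ [l fl] _] := C_lP f.
(* A tolerance [e] yields [|f 0 - l| < 2e/(1-e) |f 0|] from the target (1, 1) and
   [|l| < e/(1-e) |f 0|] from (1, 0). These contradict the triangle inequality once [3e <= 1-e],
   that is, [e <= 1/4]. *)
have e0 : 0 < 1 / 4 :> R by lra.
have [a [a0 al]] := dense_cesaro_orbit_boundary 1 1 fd fl e0.
have [b [b0 bl]] := dense_cesaro_orbit_boundary 1 0 fd fl e0.
have tri (z w : R[i]) : normc z <= normc w + normc (z - w).
  by rewrite -{1}[z](subrK w) addrC le_normcD.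
have abd : normc a * normc (f 0 - l) < 1 / 2.
  have -> : normc a * normc (f 0 - l) = normc ((1%:C - a * l) - (1%:C - a * f 0)).
    by rewrite -normcM mulrBr opprB [in RHS]addrC subrKA.
  have := le_normcD (1%:C - a * l) (- (1%:C - a * f 0)).
  by rewrite normcN; lra.
have n1 : normc (1%:C : R[i]) = 1 by rewrite /= expr0n addr0 expr1n sqrtr1.
have af : 3 / 4 < normc a * normc (f 0).
  by rewrite -normcM; have := tri 1%:C (a * f 0); rewrite n1; lra.
have bf : 3 / 4 < normc b * normc (f 0).
  by rewrite -normcM; have := tri 1%:C (b * f 0); rewrite n1; lra.
have bl' : normc b * normc l < 1 / 4 by move: bl; rewrite sub0r normcN normcM.
have := tri (f 0) l.
(* Only real inequalities between moduli remain. *)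
move: (normc_ge0 a) (normc_ge0 b) abd af bf bl'; clear.
move: (normc a) (normc b) (normc (f 0)) (normc l) (normc (f 0 - l)).
move=> A B p q d A0 B0 ? ? ? ? pqd.
(* A zero scalar would contradict [3/4 < A * p] or [3/4 < B * p]; positivity lets [A] and [B] be
   cancelled below. *)
have {}A0 : 0 < A by rewrite lt_neqAle A0 andbT; apply/eqP => A0'; subst A; lra.
have {}B0 : 0 < B by rewrite lt_neqAle B0 andbT; apply/eqP => B0'; subst B; lra.
have h1 : d < 2 / 3 * p by rewrite -(ltr_pM2l A0); lra.
have h2 : q < 1 / 3 * p by rewrite -(ltr_pM2l B0); lra.
lra.
Qed.
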